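(* Let $k$ be a field and let $P=\{(0,0),(1,0),(0,1),(1,1)\}$ be the square poset with the product order. Let $M$ be the hook-shaped module over $P$, i.e. the $P$-persistence module with $M_{(0,0)}=k$, $M_{(1,0)}=k$, $M_{(0,1)}=M_{(1,1)}=0$, whose structure map $M_{(0,0)}\to M_{(1,0)}$ is $\mathrm{id}_k$ and whose structure maps along the other three covering relations are zero. Then $\mathrm{Ext}^1(M,M)=0$ and $\mathrm{Ext}^2(M,M)=0$.
   Context: For a poset $P$, viewed as a small category with a unique morphism $p\to q$ whenever $p\le q$, a $P$-persistence module is a (covariant) functor $M:P\to\mathbf{Vec}_k$ to the category of $k$-vector spaces. For finite $P$, finite-dimensional $P$-persistence modules are identified with finite-dimensional modules over the incidence algebra $A=kP$, and $\mathrm{Ext}^i=\mathrm{Ext}^i_A$ is computed in this abelian category (equivalently, in the functor category). For the square poset, the covering relations are $f_x:(0,0)\to(1,0)$, $f_y:(0,0)\to(0,1)$, $g_y:(1,0)\to(1,1)$, $g_x:(0,1)\to(1,1)$, so a persistence module is a representation of this quiver subject to the commutativity relation $g_y\circ f_x=g_x\circ f_y$. *)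

(* Defs.v *)
From HB Require Import structures.
From mathcomp Require Import all_boot all_order all_algebra.
From mathcomp Require Import generic_quotient ring_quotient.
From mathcomp Require Import boolp classical_sets functions cardinality fsbigop.

Set Implicit Arguments.
Unset Strict Implicit.
Unset Printing Implicit Defensive.

Import Order.TTheory GRing.Theory.

Local Open Scope ring_scope.

#[local] Obligation Tactic := idtac.

Section QuotientSpace.
Variables (K : fieldType) (V : lmodType K) (I : submodClosed V).
Local Open Scope quotient_scope.

(* [submodClosed] does not record closure under opposites. *)
Definition sub_mem : {pred V} := I.

Fact sub_mem_zmod_closed : zmod_closed sub_mem.
Proof.
split=> [|x y xI yI]; first exact: (rpred0 I).
by rewrite -scaleN1r; apply: (rpredD (S := I)) => //; apply: (rpredZ (s := I)).
Qed.
HB.instance Definition _ := GRing.isZmodClosed.Build V sub_mem sub_mem_zmod_closed.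

Definition quot_space := Quotient.quot sub_mem.

HB.instance Definition _ := GRing.Zmodule.on quot_space.
HB.instance Definition _ := EqQuotient.on quot_space.

Definition quot_scale (a : K) (x : quot_space) : quot_space :=
  \pi_quot_space (a *: repr x).

Fact quot_pi_eq (x y : V) :
  (\pi_quot_space x = \pi_quot_space y) <-> (x - y \in I).
Proof.
rewrite -[_ \in I]/(x - y \in sub_mem) (Quotient.idealrBE sub_mem).
by split=> [h|/eqP]; first exact/eqP.
Qed.

Fact quot_scale_pi a x : quot_scale a (\pi_quot_space x) = \pi_quot_space (a *: x).
Proof.
apply/quot_pi_eq; rewrite -scalerBr; apply: rpredZ; apply/quot_pi_eq.
exact: reprK.
Qed.

Fact quot_piD x y :
  \pi_quot_space (x + y) = \pi_quot_space x + \pi_quot_space y.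
Proof. exact: (Quotient.pi_add sub_mem). Qed.

Fact quot_scaleA a b x : quot_scale a (quot_scale b x) = quot_scale (a * b) x.
Proof. by rewrite -[x]reprK (quot_scale_pi b) !quot_scale_pi scalerA. Qed.
Fact quot_scale1 : left_id 1 quot_scale.
Proof. by move=> x; rewrite -[x]reprK quot_scale_pi scale1r. Qed.
Fact quot_scaleDr : right_distributive quot_scale +%R.
Proof.
move=> a x y; rewrite -[x]reprK -[y]reprK.
by rewrite -quot_piD !quot_scale_pi scalerDr quot_piD.
Qed.
Fact quot_scaleDl x : {morph quot_scale^~ x : a b / a + b}.
Proof. by move=> a b; rewrite -[x]reprK !quot_scale_pi scalerDl quot_piD. Qed.

HB.instance Definition _ := GRing.Zmodule_isLmodule.Build K quot_space
  quot_scaleA quot_scale1 quot_scaleDr quot_scaleDl.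

End QuotientSpace.

Record pmodule (K : fieldType) (d : Order.disp_t) (P : porderType d) := PModule {
  pm_obj :> P -> lmodType K;
  pm_map : forall p q : P, (p <= q)%O -> {linear pm_obj p -> pm_obj q};
  pm_map_id : forall (p : P) (h : (p <= p)%O) (x : pm_obj p), pm_map h x = x;
  pm_map_comp : forall (p q r : P) (hpq : (p <= q)%O) (hqr : (q <= r)%O)
      (hpr : (p <= r)%O) (x : pm_obj p),
    pm_map hqr (pm_map hpq x) = pm_map hpr x
}.
Arguments pm_map {K d P} M {p q} h : rename.

Record pmhom (K : fieldType) (d : Order.disp_t) (P : porderType d)
    (M N : pmodule K P) := PMHom {
  pmh_fun :> forall p : P, {linear M p -> N p};
  pmh_natural : forall (p q : P) (h : (p <= q)%O) (x : M p),
    pmh_fun q (pm_map M h x) = pm_map N h (pmh_fun p x)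
}.

HB.instance Definition _ K d P M N := gen_eqMixin (@pmhom K d P M N).
HB.instance Definition _ K d P M N := gen_choiceMixin (@pmhom K d P M N).

Lemma linear_ext (K : fieldType) (U V : lmodType K) (f g : {linear U -> V}) :
  f =1 g -> f = g.
Proof.
case: f g => [f [[fA] [fB]]] [g [[gA] [gB]]] /= /funext fg.
case: _ / fg in gA gB *.
by rewrite (Prop_irrelevance fA gA) (Prop_irrelevance fB gB).
Qed.

Section PersistenceModules.
Variables (K : fieldType) (d : Order.disp_t) (P : porderType d).
Local Notation pmod := (pmodule K P).
Implicit Types (A B L M N : pmod).

Lemma pmhom_ext M N (f g : pmhom M N) : (forall p, f p =1 g p) -> f = g.
Proof.
case: f g => [f f_nat] [g g_nat] /= fg.
have {}fg : f = g.
  by apply: functional_extensionality_dep => p; apply: linear_ext (fg p).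
by case: _ / fg in g_nat *; rewrite (Prop_irrelevance f_nat g_nat).
Qed.

Program Definition pmhom_zero M N : pmhom M N :=
  @PMHom _ _ _ M N (fun p => \0 : {linear M p -> N p}) _.
Next Obligation. by move=> * /=; rewrite linear0. Qed.

Program Definition pmhom_opp M N (f : pmhom M N) : pmhom M N :=
  @PMHom _ _ _ M N (fun p => \- f p : {linear M p -> N p}) _.
Next Obligation. by move=> * /=; rewrite pmh_natural linearN. Qed.

Program Definition pmhom_add M N (f g : pmhom M N) : pmhom M N :=
  @PMHom _ _ _ M N (fun p => f p \+ g p : {linear M p -> N p}) _.
Next Obligation. by move=> * /=; rewrite !pmh_natural linearD. Qed.

Program Definition pmhom_scale M N (a : K) (f : pmhom M N) : pmhom M N :=
  @PMHom _ _ _ M N (fun p => a \*: f p : {linear M p -> N p}) _.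
Next Obligation. by move=> * /=; rewrite pmh_natural linearZ. Qed.

Program Definition pmhom_comp L M N (g : pmhom M N) (f : pmhom L M) : pmhom L N :=
  @PMHom _ _ _ L N (fun p => g p \o f p : {linear L p -> N p}) _.
Next Obligation. by move=> * /=; rewrite !pmh_natural. Qed.

Section HomSpace.
Variables M N : pmod.

Fact pmhom_addA : associative (@pmhom_add M N).
Proof. by move=> f g h; apply: pmhom_ext => p x /=; rewrite addrA. Qed.
Fact pmhom_addC : commutative (@pmhom_add M N).
Proof. by move=> f g; apply: pmhom_ext => p x /=; rewrite addrC. Qed.
Fact pmhom_add0 : left_id (pmhom_zero M N) (@pmhom_add M N).
Proof. by move=> f; apply: pmhom_ext => p x /=; rewrite add0r. Qed.
Fact pmhom_addN : left_inverse (pmhom_zero M N) (@pmhom_opp M N) (@pmhom_add M N).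
Proof. by move=> f; apply: pmhom_ext => p x /=; rewrite addNr. Qed.
HB.instance Definition _ := GRing.isZmodule.Build (pmhom M N)
  pmhom_addA pmhom_addC pmhom_add0 pmhom_addN.

Fact pmhom_scaleA a b (f : pmhom M N) :
  pmhom_scale a (pmhom_scale b f) = pmhom_scale (a * b) f.
Proof. by apply: pmhom_ext => p x /=; rewrite scalerA. Qed.
Fact pmhom_scale1 : left_id 1 (@pmhom_scale M N).
Proof. by move=> f; apply: pmhom_ext => p x /=; rewrite scale1r. Qed.
Fact pmhom_scaleDr : right_distributive (@pmhom_scale M N) +%R.
Proof. by move=> a f g; apply: pmhom_ext => p x /=; rewrite scalerDr. Qed.
Fact pmhom_scaleDl (f : pmhom M N) : {morph (@pmhom_scale M N)^~ f : a b / a + b}.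
Proof. by move=> a b; apply: pmhom_ext => p x /=; rewrite scalerDl. Qed.
HB.instance Definition _ := GRing.Zmodule_isLmodule.Build K (pmhom M N)
  pmhom_scaleA pmhom_scale1 pmhom_scaleDr pmhom_scaleDl.

End HomSpace.

(* Kernels and images of natural transformations are computed pointwise, so
   surjectivity and exactness are pointwise too. *)
Definition pm_surjective M N (f : pmhom M N) : Prop :=
  forall (p : P) (y : N p), exists x : M p, f p x = y.

Definition pm_exact L M N (f : pmhom L M) (g : pmhom M N) : Prop :=
  forall (p : P) (y : M p), g p y = 0 <-> exists x : L p, f p x = y.

Definition pm_projective (X : pmod) : Prop :=
  forall (M N : pmod) (g : pmhom M N) (f : pmhom X N),
    pm_surjective g -> exists h : pmhom X M, pmhom_comp g h = f.

Record proj_resolution (M : pmod) := ProjResolution {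
  res_obj :> nat -> pmod;
  res_diff : forall n, pmhom (res_obj n.+1) (res_obj n);
  res_aug : pmhom (res_obj 0%N) M;
  res_projective : forall n, pm_projective (res_obj n);
  res_aug_surjective : pm_surjective res_aug;
  res_aug_exact : pm_exact (res_diff 0%N) res_aug;
  res_diff_exact : forall n, pm_exact (res_diff n.+1) (res_diff n)
}.

(* [Ext R N n] is the n-th right derived functor of [Hom(-, N)] at [M], computed
   from the projective resolution [R] of [M]; [free_resolution] below provides
   such a resolution for every [M]. *)
Section Ext.
Variables (M : pmod) (R : proj_resolution M) (N : pmod).

Definition cocycle_mem n : {pred pmhom (R n) N} :=
  fun f => pmhom_comp f (res_diff R n) == 0.

Fact cocycle_submod_closed n : submod_closed (@cocycle_mem n).
Proof.
split; first by apply/eqP; exact: pmhom_ext.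
move=> a f g /eqP f0 /eqP g0; apply/eqP/pmhom_ext => p x /=.
have comp0 h : pmhom_comp h (res_diff R n) = 0 -> h p (res_diff R n p x) = 0.
  by move/(congr1 (fun u : pmhom _ _ => u p x)).
by rewrite !comp0 // scaler0 addr0.
Qed.
HB.instance Definition _ n :=
  GRing.isSubmodClosed.Build K (pmhom (R n) N) (@cocycle_mem n)
    (@cocycle_submod_closed n).

Record cocycle n := Cocycle {
  cocycle_val :> pmhom (R n) N;
  cocycle_valP : cocycle_val \in @cocycle_mem n
}.
HB.instance Definition _ n := [isSub for @cocycle_val n].
HB.instance Definition _ n := [Choice of cocycle n by <:].
HB.instance Definition _ n := [SubChoice_isSubLmodule of cocycle n by <:].

Definition is_coboundary n : cocycle n -> Prop :=
  match n with
  | 0 => fun f => val f = 0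
  | m.+1 => fun f => exists g : pmhom (R m) N, val f = pmhom_comp g (res_diff R m)
  end.

Definition coboundary_mem n : {pred cocycle n} := fun f => `[< is_coboundary f >].

Fact coboundary_submod_closed n : submod_closed (@coboundary_mem n).
Proof.
case: n => [|n]; split.
- by apply/asboolP.
- move=> a f g /asboolP /= f0 /asboolP /= g0; apply/asboolP.
  by rewrite /= f0 g0 scaler0 addr0.
- by apply/asboolP; exists 0; exact: pmhom_ext.
move=> a f g /asboolP[f' fE] /asboolP[g' gE]; apply/asboolP.
by exists (a *: f' + g'); rewrite linearP /= fE gE; exact: pmhom_ext.
Qed.
HB.instance Definition _ n :=
  GRing.isSubmodClosed.Build K (cocycle n) (@coboundary_mem n)
    (@coboundary_submod_closed n).

Definition Ext n : lmodType K := @quot_space K (cocycle n) (@coboundary_mem n).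

End Ext.

Section FreeModule.
Variables (T : choiceType) (deg : T -> P).

(* The free module on generators [t] placed at [deg t]: at [p] it consists of
   the finitely supported functions on [{t | deg t <= p}]. *)
Definition free_mem (p : P) : {pred T -> K^o} := fun f =>
  `[< finite_set [set t | f t != 0] /\ forall t, f t != 0 -> (deg t <= p)%O >].

Fact free_submod_closed p : submod_closed (free_mem p).
Proof.
split=> [|a f g /asboolP[finf degf] /asboolP[fing degg]]; apply/asboolP.
  split=> [|t]; last by rewrite eqxx.
  by apply: (sub_finite_set (B := set0)) => // t /=; rewrite eqxx.
have nz t : (a *: f + g) t != 0 -> f t != 0 \/ g t != 0.
  have [f0|] := eqVneq (f t) 0; last by left.
  by rewrite fctE /= fctE f0 scaler0 add0r; right.
split=> [|t /nz[/degf|/degg] //].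
have : finite_set ([set t | f t != 0] `|` [set t | g t != 0]) by rewrite finite_setU.
by apply: sub_finite_set => t /nz.
Qed.
HB.instance Definition _ p :=
  GRing.isSubmodClosed.Build K (T -> K^o) (free_mem p) (free_submod_closed p).

Record free_obj (p : P) := FreeObj {
  free_val :> T -> K^o;
  free_valP : free_val \in free_mem p
}.
HB.instance Definition _ p := [isSub for @free_val p].
HB.instance Definition _ p := [Choice of free_obj p by <:].
HB.instance Definition _ p := [SubChoice_isSubLmodule of free_obj p by <:].

Fact free_mem_le (p q : P) (h : (p <= q)%O) (f : free_obj p) :
  free_val f \in free_mem q.
Proof.
have /asboolP[finf degf] := free_valP f.
by apply/asboolP; split=> // t /degf /le_trans; apply.
Qed.

Definition free_map (p q : P) (h : (p <= q)%O) (f : free_obj p) : free_obj q :=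
  FreeObj (free_mem_le h f).

Fact free_map_linear p q (h : (p <= q)%O) : linear (free_map h).
Proof. by move=> a f g; apply: val_inj. Qed.
HB.instance Definition _ p q h :=
  GRing.isLinear.Build K (free_obj p) (free_obj q) *:%R (@free_map p q h)
    (free_map_linear h).

Program Definition free_pmod : pmod :=
  @PModule K d P free_obj
    (fun p q h => free_map h : {linear free_obj p -> free_obj q}) _ _.
Next Obligation. by move=> p h x; apply: val_inj. Qed.
Next Obligation. by move=> p q r hpq hqr hpr x; apply: val_inj. Qed.

Fact free_gen_mem t : (fun s => (s == t)%:R) \in free_mem (deg t).
Proof.
apply/asboolP; split=> [|s].
  by apply: (sub_finite_set _ (finite_set1 t)) => s /=; case: (eqVneq s t) => //; rewrite eqxx.
by case: (eqVneq s t) => [-> //|]; rewrite eqxx.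
Qed.
Definition free_gen t : free_pmod (deg t) := FreeObj (free_gen_mem t).

Section FreeExtension.
Variables (A : pmod) (v : forall t, A (deg t)).

Definition free_push (p : P) (t : T) : A p :=
  if @idP (deg t <= p)%O is ReflectT h then pm_map A h (v t) else 0.

Lemma free_pushE p t (h : (deg t <= p)%O) : free_push p t = pm_map A h (v t).
Proof.
by rewrite /free_push; case: {-}_ / idP => [h'|//]; rewrite (bool_irrelevance h' h).
Qed.

Definition free_ext_fun (p : P) (f : free_pmod p) : A p :=
  \sum_(t \in [set: T]) free_val f t *: free_push p t.

Lemma free_ext_seq p (f : free_pmod p) (r : seq T) : uniq r ->
    (forall t, free_val f t != 0 -> t \in r) ->
  free_ext_fun f = \sum_(t <- r) free_val f t *: free_push p t.
Proof.
move=> r_uniq fr; rewrite /free_ext_fun (fsbigE r) //; first last.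
  move=> t _ tr; have [->|/fr] := eqVneq (free_val f t) 0; first by rewrite scale0r.
  by rewrite (negPf tr).
by apply: eq_bigl => t; rewrite in_setT.
Qed.

End FreeExtension.

Lemma free_supp p (f : free_pmod p) :
  exists r, uniq r /\ forall t, free_val f t != 0 -> t \in r.
Proof.
have /asboolP[/finite_seqP[r rE] _] := free_valP f.
exists (undup r); split=> [|t tf]; first exact: undup_uniq.
by rewrite mem_undup; have : [set t | free_val f t != 0]%classic t by []; rewrite rE.
Qed.

Fact free_ext_linear A v p : linear (@free_ext_fun A v p).
Proof.
move=> a f g; have [r [_ fr]] := free_supp f; have [s [_ gs]] := free_supp g.
have nz t : free_val (a *: f + g) t != 0 -> t \in undup (r ++ s).
  rewrite mem_undup mem_cat; have [f0|/fr -> //] := eqVneq (free_val f t) 0.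
  have [g0|/gs -> //] := eqVneq (free_val g t) 0; last by rewrite orbT.
  by rewrite /= fctE /= fctE f0 g0 scaler0 addr0 eqxx.
rewrite !(@free_ext_seq _ _ _ _ (undup (r ++ s))) ?undup_uniq //.
- rewrite scaler_sumr -big_split /=; apply: eq_bigr => t _.
  by rewrite fctE /= fctE scalerDl scalerA.
- by move=> t /gs; rewrite mem_undup mem_cat orbC => ->.
- by move=> t /fr; rewrite mem_undup mem_cat => ->.
Qed.
HB.instance Definition _ (A : pmod) v p :=
  GRing.isLinear.Build K (free_pmod p) (A p) *:%R (@free_ext_fun A v p)
    (@free_ext_linear A v p).

Program Definition free_ext (A : pmod) (v : forall t, A (deg t)) : pmhom free_pmod A :=
  @PMHom _ _ _ free_pmod A
    (fun p => @free_ext_fun A v p : {linear free_pmod p -> A p}) _.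
Next Obligation.
move=> A v p q h f /=; have [r [ru fr]] := free_supp f.
rewrite !(@free_ext_seq _ _ _ _ r) // linear_sum; apply: eq_bigr => t _ /=.
rewrite linearZ /=; have [->|ft] := eqVneq (free_val f t) 0; first by rewrite !scale0r.
have /asboolP[_ /(_ t ft) tp] := free_valP f.
rewrite (free_pushE _ tp) (free_pushE _ (le_trans tp h)).
by rewrite (pm_map_comp _ _ (le_trans tp h)).
Qed.

Lemma free_ext_gen A v t : @free_ext A v (deg t) (free_gen t) = v t.
Proof.
rewrite /= (@free_ext_seq _ _ _ _ [:: t]) //.
  by rewrite big_seq1 /= eqxx scale1r (free_pushE _ (lexx _)) pm_map_id.
by move=> s /=; rewrite inE; case: (eqVneq s t) => //; rewrite eqxx.
Qed.

Lemma free_hom_ext A (h : pmhom free_pmod A) :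
  h = free_ext (fun t => h (deg t) (free_gen t)).
Proof.
apply: pmhom_ext => p f /=; have [r [ru fr]] := free_supp f.
rewrite (@free_ext_seq _ _ _ _ r) //.
have {1}-> : f = \sum_(t <- r) free_val f t *: free_push free_gen p t.
  apply: val_inj; rewrite linear_sum /=; apply: funext => s.
  rewrite fct_sumE /=.
  have [fs|fs] := eqVneq (free_val f s) 0.
    rewrite fs big1_seq // => t _ /=; rewrite fctE.
    have [->|ft] := eqVneq (free_val f t) 0; first by rewrite scale0r.
    have /asboolP[_ /(_ t ft) tp] := free_valP f.
    rewrite (free_pushE _ tp) /=; case: eqVneq => [st|]; last by rewrite scaler0.
    by rewrite -st fs eqxx in ft.
  rewrite (bigD1_seq s) ?fr //= big1 ?addr0 => [|t ts]; rewrite fctE.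
    have /asboolP[_ /(_ s fs) sp] := free_valP f.
    by rewrite (free_pushE _ sp) /= eqxx; rewrite /GRing.scale /= mulr1.
  have [->|ft] := eqVneq (free_val f t) 0; first by rewrite scale0r.
  have /asboolP[_ /(_ t ft) tp] := free_valP f.
  by rewrite (free_pushE _ tp) /= eq_sym (negPf ts) scaler0.
rewrite linear_sum; apply: eq_bigr => t _; rewrite linearZ /=.
have [->|ft] := eqVneq (free_val f t) 0; first by rewrite !scale0r.
have /asboolP[_ /(_ t ft) tp] := free_valP f.
by rewrite !(free_pushE _ tp) -pmh_natural.
Qed.

Lemma free_projective : pm_projective free_pmod.
Proof.
move=> A B g f g_surj.
pose v t := projT1 (cid (g_surj (deg t) (f (deg t) (free_gen t)))).
have vE t : g (deg t) (v t) = f (deg t) (free_gen t) by rewrite /v; case: cid.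
exists (free_ext v); rewrite [LHS]free_hom_ext [RHS]free_hom_ext.
by congr free_ext; apply: functional_extensionality_dep => t /=; rewrite -vE free_ext_gen.
Qed.

End FreeModule.

Section Kernel.
Variables (M N : pmod) (f : pmhom M N).

Definition ker_mem p : {pred M p} := fun x => f p x == 0.
Fact ker_submod_closed p : submod_closed (@ker_mem p).
Proof.
split=> [|a x y /eqP x0 /eqP y0]; apply/eqP; first by rewrite linear0.
by rewrite linearP x0 y0 scaler0 addr0.
Qed.
HB.instance Definition _ p :=
  GRing.isSubmodClosed.Build K (M p) (@ker_mem p) (@ker_submod_closed p).

Record ker_obj p := KerObj { ker_val :> M p; ker_valP : ker_val \in @ker_mem p }.
HB.instance Definition _ p := [isSub for @ker_val p].
HB.instance Definition _ p := [Choice of ker_obj p by <:].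
HB.instance Definition _ p := [SubChoice_isSubLmodule of ker_obj p by <:].

Fact ker_val_linear p : linear (@ker_val p).
Proof. by []. Qed.
HB.instance Definition _ p :=
  GRing.isLinear.Build K (ker_obj p) (M p) *:%R (@ker_val p) (@ker_val_linear p).

Fact ker_mem_map p q (h : (p <= q)%O) (x : ker_obj p) :
  pm_map M h (ker_val x) \in @ker_mem q.
Proof.
by have /eqP x0 := ker_valP x; apply/eqP; rewrite pmh_natural x0 linear0.
Qed.
Definition ker_map p q (h : (p <= q)%O) (x : ker_obj p) : ker_obj q :=
  KerObj (ker_mem_map h x).
Fact ker_map_linear p q (h : (p <= q)%O) : linear (ker_map h).
Proof. by move=> a x y; apply: val_inj; rewrite /= linearP. Qed.
HB.instance Definition _ p q h :=
  GRing.isLinear.Build K (ker_obj p) (ker_obj q) *:%R (@ker_map p q h)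
    (ker_map_linear h).

Program Definition ker_pmod : pmod :=
  @PModule K d P ker_obj
    (fun p q h => ker_map h : {linear ker_obj p -> ker_obj q}) _ _.
Next Obligation. by move=> p h x; apply: val_inj; rewrite /= pm_map_id. Qed.
Next Obligation.
by move=> p q r hpq hqr hpr x; apply: val_inj; rewrite /= (pm_map_comp _ _ hpr).
Qed.

Program Definition ker_incl : pmhom ker_pmod M :=
  @PMHom _ _ _ ker_pmod M (fun p => @ker_val p : {linear ker_obj p -> M p}) _.
Next Obligation. by []. Qed.

End Kernel.

Definition gen_deg M (t : {p : P & M p}) : P := tag t.
Definition cover M : pmod := @free_pmod {p : P & M p} (@gen_deg M).
Definition cover_map M : pmhom (cover M) M := free_ext (fun t => tagged t).

Lemma cover_map_surjective M : pm_surjective (cover_map M).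
Proof.
move=> p y; exists (free_gen (@gen_deg M) (existT (fun p : P => M p) p y)).
exact: (free_ext_gen (deg := @gen_deg M) (fun t => tagged t) (existT _ p y)).
Qed.

Fixpoint syzygy M (n : nat) : pmod :=
  if n is m.+1 then ker_pmod (cover_map (syzygy M m)) else M.

Definition free_res_diff M n : pmhom (cover (syzygy M n.+1)) (cover (syzygy M n)) :=
  pmhom_comp (ker_incl (cover_map (syzygy M n))) (cover_map (syzygy M n.+1)).

Fact free_res_exact M n : pm_exact (free_res_diff M n) (cover_map (syzygy M n)).
Proof.
move=> p y; split=> [/eqP y0|[x <-]]; last exact/eqP/ker_valP.
by have [x xE] := cover_map_surjective (KerObj y0 : syzygy M n.+1 p);
  exists x; rewrite /= xE.
Qed.

Fact free_res_diff_exact M n : pm_exact (free_res_diff M n.+1) (free_res_diff M n).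
Proof.
move=> p y; rewrite -free_res_exact /=; split=> [y0|-> //].
exact: val_inj.
Qed.

Definition free_resolution M : proj_resolution M :=
  @ProjResolution M (fun n => cover (syzygy M n)) (free_res_diff M) (cover_map M)
    (fun n => @free_projective _ (@gen_deg (syzygy M n))) (@cover_map_surjective M)
    (@free_res_exact M 0%N) (@free_res_diff_exact M).

End PersistenceModules.

(* [false] is 0 and [true] is 1; [*p] carries the product order. *)
Notation square := (bool *p bool)%type.

Section Hook.
Variable K : fieldType.

Definition hook_obj (p : square) : lmodType K :=
  match p with
  | (false, false) => K^o
  | (true, false) => K^o
  | (false, true) => 'rV[K]_0
  | (true, true) => 'rV[K]_0
  end.

(* The junk value at [(true, false), (false, false)] is never used, these two
   elements being in the wrong order. *)
Definition hook_map (p q : square) : {linear hook_obj p -> hook_obj q} :=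
  match p, q return {linear hook_obj p -> hook_obj q} with
  | (false, false), (false, false) => idfun : {linear K^o -> K^o}
  | (false, false), (true, false) => idfun : {linear K^o -> K^o}
  | (true, false), (true, false) => idfun : {linear K^o -> K^o}
  | _, _ => \0
  end.

Program Definition hook : pmodule K square :=
  @PModule K _ square hook_obj (fun p q _ => hook_map p q) _ _.
Next Obligation.
by move=> [[] []] h x //=; rewrite [x]thinmx0.
Qed.
Next Obligation.
by move=> [[] []] [[] []] [[] []] hpq hqr hpr x //=; rewrite ?linear0.
Qed.

End Hook.

(* Main.v *)
Require Import Defs.
From HB Require Import structures.
From mathcomp Require Import all_boot all_order all_algebra.
From mathcomp Require Import boolp.

(* The hook is the cokernel of an injection i : Q1 -> Q0, where Q0 and Q1 are
   free on one generator, placed at (0,0) and (0,1) respectively.  Comparing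
   0 -> Q1 -> Q0 with an arbitrary projective resolution R by chain maps and a
   homotopy shows that Ext^i vanishes for i >= 2, and that every 1-cocycle
   R_1 -> N is, up to a coboundary, of the form R_1 -> Q1 -> N; but
   Hom(Q1, N) = N_(0,1), which is zero for the hook. *)

Set Implicit Arguments.
Unset Strict Implicit.
Unset Printing Implicit Defensive.

Import Order.TTheory GRing.Theory.

Local Open Scope ring_scope.

(** * Lifting maps out of projective modules *)

Section ProjectiveModules.
Variables (K : fieldType) (d : Order.disp_t) (P : porderType d).
Implicit Types L M N X : pmodule K P.

Definition pmhom_id M : pmhom M M :=
  @PMHom _ _ _ M M (fun p => idfun : {linear M p -> M p})
    (fun _ _ _ _ => erefl).

Section KernelFactorization.
Variables (X M N : pmodule K P) (g : pmhom M N) (f : pmhom X M).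
Hypothesis gf0 : forall p x, g p (f p x) = 0.

Fact ker_fact_mem p x : f p x \in @ker_mem _ _ _ _ _ g p.
Proof. exact/eqP/gf0. Qed.

Definition ker_fact_fun p (x : X p) : ker_pmod g p := KerObj (ker_fact_mem x).

Fact ker_fact_linear p : linear (@ker_fact_fun p).
Proof. by move=> a x y; apply: val_inj; rewrite /= linearP. Qed.
HB.instance Definition _ p :=
  GRing.isLinear.Build K (X p) (ker_pmod g p) *:%R (@ker_fact_fun p)
    (@ker_fact_linear p).

Fact ker_fact_natural p q (h : (p <= q)%O) (x : X p) :
  ker_fact_fun (pm_map X h x) = pm_map (ker_pmod g) h (ker_fact_fun x).
Proof. by apply: val_inj; rewrite /= pmh_natural. Qed.

Definition ker_fact : pmhom X (ker_pmod g) :=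
  @PMHom _ _ _ X (ker_pmod g)
    (fun p => @ker_fact_fun p : {linear X p -> ker_pmod g p}) ker_fact_natural.

End KernelFactorization.

Lemma surjective_lift X M N (e : pmhom M N) (f : pmhom X N) :
    pm_projective X -> pm_surjective e ->
  exists h : pmhom X M, forall p x, e p (h p x) = f p x.
Proof. by move=> prX /(prX _ _ e f)[h hE]; exists h => p x; rewrite -hE. Qed.

(** By exactness [u] corestricts to a surjection onto the kernel of [g], and [f] factors through
    that kernel. *)
Lemma exact_lift X L M N (u : pmhom L M) (g : pmhom M N) (f : pmhom X M) :
    pm_projective X -> pm_exact u g -> (forall p x, g p (f p x) = 0) ->
  exists h : pmhom X L, forall p x, u p (h p x) = f p x.
Proof.
move=> prX ex gf0.
have gu0 p x : g p (u p x) = 0 by apply/ex; exists x.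
have u_surj : pm_surjective (ker_fact gu0).
  move=> p [y y0]; have /ex[x xE] : g p y = 0 by exact/eqP.
  by exists x; apply: val_inj.
have [h hE] := surjective_lift (ker_fact gf0) prX u_surj.
by exists h => p x; have /(congr1 val) := hE p x.
Qed.

(** * Modules of projective dimension at most one *)

Section ProjectiveDimensionOne.
Variables (M Q1 Q0 : pmodule K P) (i : pmhom Q1 Q0) (e : pmhom Q0 M).
Hypotheses (prQ1 : pm_projective Q1) (prQ0 : pm_projective Q0).
Hypotheses (i_inj : forall p, injective (i p)) (ie_exact : pm_exact i e).
Hypothesis e_surj : pm_surjective e.
Variables (R : proj_resolution M) (N : pmodule K P).

Local Notation D := (res_diff R).

Lemma res_aug_diff0 p x : res_aug R p (D 0 p x) = 0.
Proof. by apply/res_aug_exact; exists x. Qed.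

Lemma res_diff_diff0 n p x : D n p (D n.+1 p x) = 0.
Proof. by apply/res_diff_exact; exists x. Qed.

(* A homotopy from the composite R -> (0 -> Q1 -> Q0) -> R of comparison maps to
   the identity; [a1] and [b1] are the degree-1 parts of these maps. *)
Lemma res_homotopy : exists (h : pmhom (R 0) (R 1)) (a1 : pmhom (R 1) Q1)
    (b1 : pmhom Q1 (R 1)),
  (forall p x, a1 p (D 1 p x) = 0) /\
  (forall p x, D 0 p (x - h p (D 0 p x) - b1 p (a1 p x)) = 0).
Proof.
have [a aE] := surjective_lift (res_aug R) (@res_projective _ _ _ _ R 0) e_surj.
have [b bE] := surjective_lift e prQ0 (@res_aug_surjective _ _ _ _ R).
have ei0 p x : e p (i p x) = 0 by apply/ie_exact; exists x.
(* The map lifted to [h] is [id - b a]; the augmentation kills it since it sends [b a] to [e a],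
   which is the augmentation again. *)
have [h hE] := @exact_lift _ _ _ _ _ _
  (pmhom_add (pmhom_id (R 0)) (pmhom_opp (pmhom_comp b a)))
  (@res_projective _ _ _ _ R 0) (@res_aug_exact _ _ _ _ R)
  (fun p x => ltac:(by rewrite /= linearB /= bE aE subrr)).
have [a1 a1E] := @exact_lift _ _ _ _ _ _ (pmhom_comp a (D 0))
  (@res_projective _ _ _ _ R 1) ie_exact
  (fun p x => ltac:(by rewrite /= aE res_aug_diff0)).
have [b1 b1E] := @exact_lift _ _ _ _ _ _ (pmhom_comp b i)
  prQ1 (@res_aug_exact _ _ _ _ R) (fun p x => ltac:(by rewrite /= bE ei0)).
exists h, a1, b1; split=> p x.
  by apply: i_inj; rewrite a1E /= res_diff_diff0 !linear0.
(* Here [D 0 h = id - b a] and [D 0 b1 a1 = b i a1 = b a D 0], so all terms cancel. *)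
by rewrite !linearB /= hE b1E /= a1E /= subKr subrr.
Qed.

(** The complex Q1 -> Q0 vanishes from degree 2 on, so there the homotopy contracts R: each new [h1]
    lifts [id - h D], whose correction term dies on boundaries. *)
Lemma res_diff_split n : exists h : pmhom (R n.+1) (R n.+2),
  forall p x, D n.+1 p (h p (D n.+1 p x)) = D n.+1 p x.
Proof.
elim: n => [|n [h hE]].
  have [h [a1 [b1 [a1D hE]]]] := res_homotopy.
  have [h1 h1E] := @exact_lift _ _ _ _ _ _
    (pmhom_add (pmhom_add (pmhom_id (R 1)) (pmhom_opp (pmhom_comp h (D 0))))
      (pmhom_opp (pmhom_comp b1 a1)))
    (@res_projective _ _ _ _ R 1) (@res_diff_exact _ _ _ _ R 0) hE.
  by exists h1 => p x; rewrite h1E /= res_diff_diff0 a1D !linear0 !addr0.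
have [h1 h1E] := @exact_lift _ _ _ _ _ _
  (pmhom_add (pmhom_id (R n.+2)) (pmhom_opp (pmhom_comp h (D n.+1))))
  (@res_projective _ _ _ _ R n.+2) (@res_diff_exact _ _ _ _ R n.+1)
  (fun p x => ltac:(by rewrite /= linearB /= hE subrr)).
by exists h1 => p x; rewrite h1E /= res_diff_diff0 !linear0 addr0.
Qed.

Lemma cocycle_comp0 n (f : cocycle R N n) p x : f p (D n p x) = 0.
Proof. by have /eqP/(congr1 (fun u : pmhom _ _ => u p x)) := cocycle_valP f. Qed.

Lemma cocycle_ker0 n (f : cocycle R N n.+1) p x : D n p x = 0 -> f p x = 0.
Proof. by move/res_diff_exact => [y <-]; apply: cocycle_comp0. Qed.

Lemma Ext_eq0 n :
    (forall f : cocycle R N n.+1, exists g : pmhom (R n) N,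
       forall p x, f p x = g p (D n p x)) ->
  forall x : Ext R N n.+1, x = 0.
Proof.
move=> fE x; rewrite -[x]reprK -[0]reprK; apply/quot_pi_eq.
(* The chosen representative of 0 need not be 0, so the hypothesis is applied to the difference. *)
have [g gE] := fE (repr x - repr (0 : Ext R N n.+1)).
by apply/asboolP; exists g; apply: pmhom_ext => p y; exact: gE.
Qed.

Lemma Ext1_eq0 : (forall g : pmhom Q1 N, g = 0) ->
  forall x : Ext R N 1, x = 0.
Proof.
move=> Q1N; apply: Ext_eq0 => f; have [h [a1 [b1 [_ hE]]]] := res_homotopy.
(* The cocycle kills the kernel of [D 0], so [f = f h D 0 + f b1 a1], and [f b1] is a map from Q1 to
   N. *)
exists (pmhom_comp f h) => p x /=; have /cocycle_ker0 := hE p x.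
move=> /(_ f); rewrite !linearB /=.
have fb0 : f p (b1 p (a1 p x)) = 0.
  exact: (congr1 (fun u : pmhom _ _ => u p (a1 p x)) (Q1N (pmhom_comp f b1))).
rewrite fb0.
by rewrite subr0 => /eqP; rewrite subr_eq0 => /eqP.
Qed.

Lemma Ext_ge2_eq0 n (x : Ext R N n.+2) : x = 0.
Proof.
move: x; apply: Ext_eq0 => f; have [h hE] := res_diff_split n.
exists (pmhom_comp f h) => p x /=; apply/eqP; rewrite -subr_eq0 -linearB /=.
by apply/eqP/cocycle_ker0; rewrite linearB /= hE subrr.
Qed.

End ProjectiveDimensionOne.
End ProjectiveModules.

(** * The length-one projective resolution of the hook *)

Section HookResolution.
Variable K : fieldType.
Local Notation hook := (hook K).

(** The representable module at [q]: a line on the up-set of [q], with coordinate [free_val x tt],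
    and zero elsewhere. *)
Definition principal (q : square) : pmodule K square :=
  free_pmod K (fun _ : unit => q).

Lemma principal_projective q : pm_projective (principal q).
Proof. exact: free_projective. Qed.

Lemma principal_eq0 q p (x : principal q p) : ~~ (q <= p)%O -> x = 0.
Proof.
have /asboolP[_ xq] := free_valP x; move=> qp; apply: val_inj.
apply: funext => t /=; apply/eqP; apply: contraNT qp; exact: xq.
Qed.

Lemma principal_coef q p (h : (q <= p)%O) (c : K) :
  exists x : principal q p, free_val x tt = c.
Proof.
by exists (c *: free_map h (free_gen K (fun _ : unit => q) tt)); apply: mulr1.
Qed.

(** Yoneda: a map out of [principal q] is determined by the image of its generator in [A q]. *)
Lemma principal_ext_eq0 q (A : pmodule K square) (f : pmhom (principal q) A) :
  (forall y : A q, y = 0) -> f = 0.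
Proof.
move=> Aq; rewrite [f]free_hom_ext [0]free_hom_ext; congr free_ext.
by apply: functional_extensionality_dep => t; rewrite [LHS]Aq [RHS]Aq.
Qed.

Lemma principal_ext q (A : pmodule K square) (y : A q) p (x : principal q p)
    (h : (q <= p)%O) :
  @free_ext K _ square unit (fun=> q) A (fun=> y) p x
    = free_val x tt *: pm_map A h y.
Proof.
rewrite /= (@free_ext_seq _ _ _ _ _ _ _ _ _ [:: tt]) //.
by rewrite big_seq1 (free_pushE _ h).
Qed.

Let Q0 := principal (false, false).
Let Q1 := principal (false, true).

Definition hook_gen : pmhom Q0 hook :=
  free_ext (A := hook) (fun=> 1 : hook (false, false)).

(** Its image is the part of Q0 over (0,1) and (1,1), exactly where the hook vanishes. *)
Definition hook_rel : pmhom Q1 Q0 :=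
  free_ext (A := Q0) (fun=> free_map (isT : ((false, false) <= (false, true) :> square)%O)
    (free_gen K (fun _ : unit => (false, false) : square) tt)).

Lemma hook_rel_val p (x : Q1 p) : free_val (hook_rel p x) = free_val x.
Proof.
have [h|h] := boolP ((false, true) <= p :> square)%O.
  rewrite /hook_rel (principal_ext _ _ h); apply: funext => -[].
  exact: mulr1.
by rewrite (principal_eq0 x h) linear0.
Qed.

Lemma hook_rel_inj p : injective (hook_rel p).
Proof. by move=> x y xy; apply: val_inj; rewrite /= -!hook_rel_val xy. Qed.

Lemma hook_genE p (x : Q0 p) :
  hook_gen p x = free_val x tt *: hook_map K (false, false) p 1.
Proof. by apply: principal_ext; case: p x => [[] []]. Qed.

Lemma hook_gen_surjective : pm_surjective hook_gen.
Proof.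
move=> [b []] y; first by exists 0; case: b y => y; rewrite [y]thinmx0 linear0.
have h : ((false, false) <= (b, false) :> square)%O by case: b y.
have [c <-] : exists c : K, c *: hook_map K (false, false) (b, false) 1 = y.
  by case: b y {h} => y; exists y; apply: mulr1.
by have [x xE] := principal_coef h c; exists x; rewrite hook_genE xE.
Qed.

Lemma hook_rel_exact : pm_exact hook_rel hook_gen.
Proof.
move=> [b []] y; rewrite hook_genE.
  (* Over second coordinate 1 the hook is zero and [hook_rel] is onto. *)
  split=> _; last by case: b y => y; rewrite [LHS]thinmx0 [RHS]thinmx0.
  have h : ((false, true) <= (b, true) :> square)%O by case: b y.
  have [x xE] := principal_coef h (free_val y tt).
  by exists x; apply: val_inj; rewrite /= hook_rel_val; apply: funext => -[].
(* Over second coordinate 0 it is Q1 that vanishes, and [hook_gen] is injective. *)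
have y0 : (free_val y tt *: hook_map K (false, false) (b, false) 1 = 0)
    <-> (free_val y tt = 0).
  by case: b y => y; rewrite /= /GRing.scale /= mulr1.
rewrite {}y0; split=> [y0|[x <-]]; last first.
  by rewrite hook_rel_val (@principal_eq0 _ _ x) //; case: b y x.
by exists 0; rewrite linear0; apply: val_inj; apply: funext => -[].
Qed.

End HookResolution.

Theorem proposition5p4 (k : fieldType) (R : proj_resolution (hook k)) :
  (forall x : Ext R (hook k) 1, x = 0) /\
  (forall x : Ext R (hook k) 2, x = 0).
Proof.
have prQ q := @principal_projective k q.
split; last first.
  exact: (Ext_ge2_eq0 (prQ _) (prQ _) (@hook_rel_inj k) (@hook_rel_exact k)
    (@hook_gen_surjective k)).
apply: (Ext1_eq0 (prQ _) (prQ _) (@hook_rel_inj k) (@hook_rel_exact k)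
    (@hook_gen_surjective k)) => g.
by apply: principal_ext_eq0 => y; exact: thinmx0.
Qed.
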